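(* Let $F:(0,\infty)\to\mathbb{R}$, $F(t)=-\log t+(t-1)$. Then the $F$-divergence $\mathcal{D}_F$ on $\mathcal{F}^+$ is the Bregman divergence given by the potential function $\bar{\varphi}:\overline{M}\to\mathbb{R}$, $$\bar{\varphi}(\eta)=\sum_{(x,y)\in\mathcal{E}}\eta_{xy}\log\eta_{xy}-\sum_{x\in\mathcal{X}}\eta_x\log\eta^x,\qquad \eta=(\eta_{xy})_{(x,y)\in\mathcal{E}}\in\overline{M}.$$ That is, for all $f,g\in\mathcal{F}^+$, $$\mathcal{D}_F(f,g)=\mathcal{D}_{\mathrm{Bre}}(\bar{T}(f),\bar{T}(g)),$$ where for $\eta,\zeta\in\overline{M}$ $$\mathcal{D}_{\mathrm{Bre}}(\eta,\zeta)=\bar{\varphi}(\eta)-\bar{\varphi}(\zeta)+\sum_{(x,y)\in\mathcal{E}}\frac{\partial\bar{\varphi}}{\partial\eta_{xy}}(\zeta)\,(\zeta_{xy}-\eta_{xy}).$$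
   Context: Let $\mathcal{X}=\{0,1,\dots,d\}$ with $d\ge 1$ and $\mathcal{E}\subset\mathcal{X}\times\mathcal{X}$. Assume $\mathcal{E}$ is strongly connected: for any $x,y\in\mathcal{X}$ there exist $N\ge 2$ and $(x_1,x_2),(x_2,x_3),\dots,(x_{N-1},x_N)\in\mathcal{E}$ with $x_1=x$, $x_N=y$. Let $\mathcal{F}^+=\{f:\mathcal{E}\to\mathbb{R}\mid f(x,y)>0\ \text{for all }(x,y)\in\mathcal{E}\}$. For $f\in\mathcal{F}^+$ let $A(f)=[a_{ij}(f)]_{0\le i,j\le d}$ with $a_{ij}(f)=f(i,j)$ if $(i,j)\in\mathcal{E}$ and $a_{ij}(f)=0$ otherwise; this is a nonnegative irreducible matrix. Let $r(f)>0$ be its Perron-Frobenius root (the simple real eigenvalue with $r(f)\ge|\lambda|$ for every eigenvalue $\lambda$), and let $\mu_f=(\mu_f(0),\dots,\mu_f(d))^T$ be the unique left eigenvector, $\mu_f^TA(f)=r(f)\mu_f^T$, with all $\mu_f(x)>0$ and $\sum_{x}\mu_f(x)=1$. A standard convex function is a strictly convex $F:(0,\infty)\to\mathbb{R}$ with $F(1)=F'(1)=0$ and $F''(1)=1$. For such $F$ the $F$-divergence $\mathcal{D}_F:\mathcal{F}^+\times\mathcal{F}^+\to\mathbb{R}$ is $$\mathcal{D}_F(f,g)=\sum_{(x,y)\in\mathcal{E}}\mu_f(x)f(x,y)\,F\!\left(\frac{g(x,y)/r(g)}{f(x,y)/r(f)}\right).$$ Let $\overline{M}=\{\eta=(\eta_{xy})_{(x,y)\in\mathcal{E}}\mid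 \eta_{xy}>0\}\subset\mathbb{R}^{|\mathcal{E}|}$. For $\eta\in\overline{M}$ and $x\in\mathcal{X}$ put $\eta^x=\sum_{k:(k,x)\in\mathcal{E}}\eta_{kx}$ and $\eta_x=\sum_{k:(x,k)\in\mathcal{E}}\eta_{xk}$. Let $\bar{T}:\mathcal{F}^+\to\overline{M}$ be the map $f\mapsto(\mu_f(x)f(x,y))_{(x,y)\in\mathcal{E}}$, which is a diffeomorphism and identifies $\mathcal{F}^+$ with $\overline{M}$. *)

(* Defs.v *)
From HB Require Import structures.
From mathcomp Require Import all_boot all_order all_algebra.
From mathcomp Require Import complex.
From mathcomp Require Import boolp classical_sets reals topology normedtype.
From mathcomp Require Import derive exp.

Set Implicit Arguments.
Unset Strict Implicit.
Unset Printing Implicit Defensive.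

Import Order.TTheory GRing.Theory Num.Theory.
Import numFieldNormedType.Exports.

Local Open Scope classical_set_scope.
Local Open Scope ring_scope.

Section Graph.
Variables (d : nat) (E : {set 'I_d.+1 * 'I_d.+1}).

(* The walk x = x_1, ..., x_N = y is x :: s, so that N >= 2 iff s <> [::]. *)
Definition strongly_connected : Prop :=
  forall x y : 'I_d.+1, exists s : seq 'I_d.+1,
    [/\ (0 < size s)%N, path (fun a b => (a, b) \in E) x s & last x s = y].

Definition edge : finType := {e : 'I_d.+1 * 'I_d.+1 | e \in E}.

Definition src (e : edge) : 'I_d.+1 := (val e).1.
Definition tgt (e : edge) : 'I_d.+1 := (val e).2.
End Graph.

Section Perron.
Variables (R : realType) (n : nat).
Implicit Types (A : 'M[R]_n) (r : R) (mu : 'rV[R]_n).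

(* The other eigenvalues are complex, hence the base change to R[i]. Such an r
   is unique, since any two of them dominate each other. *)
Definition is_perron_root A r : Prop :=
  [/\ eigenvalue A r, mup r (char_poly A) = 1%N
    & forall lambda : R[i],
        eigenvalue (map_mx (real_complex R) A) lambda ->
        `|lambda| <= real_complex R r].

Definition perron_root A : R := xget 0 [set r | is_perron_root A r].

Definition is_perron_vector A mu : Prop :=
  [/\ mu *m A = perron_root A *: mu,
      forall x, 0 < mu 0 x & \sum_x mu 0 x = 1].

Definition perron_vector A : 'rV[R]_n := xget 0 [set mu | is_perron_vector A mu].
End Perron.

Section Divergence.
Variables (R : realType) (d : nat) (E : {set 'I_d.+1 * 'I_d.+1}).
Implicit Types (f g eta zeta : edge E -> R).

Definition Fplus : set (edge E -> R) := [set f | forall e, 0 < f e].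

Definition weight_mx f : 'M[R]_d.+1 := \matrix_(i, j) oapp f 0 (insub (i, j)).

Definition pf_root f : R := perron_root (weight_mx f).
Definition pf_vec f (x : 'I_d.+1) : R := perron_vector (weight_mx f) 0 x.

Definition Fdivergence (F : R -> R) f g : R :=
  \sum_(e : edge E)
    pf_vec f (src e) * f e * F ((g e / pf_root g) / (f e / pf_root f)).

Definition Mbar : set (edge E -> R) := [set eta | forall e, 0 < eta e].

Definition inflow eta (x : 'I_d.+1) : R := \sum_(e : edge E | tgt e == x) eta e.
Definition outflow eta (x : 'I_d.+1) : R := \sum_(e : edge E | src e == x) eta e.

Definition Tbar f : edge E -> R := fun e => pf_vec f (src e) * f e.

Definition coord_line (phi : (edge E -> R) -> R) eta (e : edge E) : R -> R :=
  fun t => phi [eta eta with e |-> t].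

Definition partial_derivable (phi : (edge E -> R) -> R) (e : edge E) eta : Prop :=
  derivable (coord_line phi eta e) (eta e) 1.

Definition partial (phi : (edge E -> R) -> R) (e : edge E) eta : R :=
  derive1 (coord_line phi eta e) (eta e).

Definition bregman (phi : (edge E -> R) -> R) eta zeta : R :=
  phi eta - phi zeta + \sum_(e : edge E) partial phi e zeta * (zeta e - eta e).

Definition phibar eta : R :=
  \sum_(e : edge E) eta e * ln (eta e)
  - \sum_(x : 'I_d.+1) outflow eta x * ln (inflow eta x).
End Divergence.

(* Main.v *)
(** The maximal [t] with [t x <= x A] for some [x] in the simplex (Collatz and
    Wielandt) is the Perron-Frobenius root of an irreducible nonnegative matrix,
    which yields [mu_f] and [r(f)].  For [eta = Tbar f], stationarity of [mu_f]
    reads [eta^x = r(f) mu_f(x)], whence [eta_xy / eta^x = f(x,y) / r(f)].  Since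
    [phibar eta] is the sum of [eta_xy log (eta_xy / eta^x)] and is homogeneous of
    degree one, Euler's identity reduces its Bregman divergence to a single sum
    over the edges, which is then compared with the [F]-divergence. *)
Require Import Defs.
From mathcomp Require Import all_boot all_order all_algebra.
From mathcomp Require Import boolp classical_sets reals topology normedtype.
From mathcomp Require Import functions realfun derive exp.
From mathcomp Require Import complex ring.

Set Implicit Arguments.
Unset Strict Implicit.
Unset Printing Implicit Defensive.

Import Order.TTheory GRing.Theory Num.Theory.
Import numFieldNormedType.Exports.

Local Open Scope ring_scope.

(** * The Collatz-Wielandt maximum of a nonnegative matrix *)

Section CollatzWielandt.
Variables (R : realType) (n : nat).
Implicit Types (A : 'M[R]_n.+1) (x y : 'rV[R]_n.+1).

(** Irreducibility is phrased through powers so that walks in the graph give it directly; [k = 0] is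
    allowed, so the diagonal pairs hold automatically. *)
Definition irreducible_mx A := forall i j, exists k, 0 < (A ^+ k) i j.

Lemma mulmx_row_ge0 A x : (forall i j, 0 <= A i j) ->
  (forall j, 0 <= x 0 j) -> forall j, 0 <= (x *m A) 0 j.
Proof.
by move=> A0 x0 j; rewrite mxE; apply: sumr_ge0 => i _; exact: mulr_ge0.
Qed.

Lemma expmx_ge0 A k : (forall i j, 0 <= A i j) ->
  forall i j, 0 <= (A ^+ k) i j.
Proof.
move=> A0; elim: k => [|k IHk] i j; first by rewrite expr0 mxE; case: eqP.
by rewrite exprS mxE; apply: sumr_ge0 => l _; exact: mulr_ge0.
Qed.

Lemma rV_neq0_gt0 x : (forall j, 0 <= x 0 j) -> x != 0 -> exists j, 0 < x 0 j.
Proof.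
move=> x0; apply: contra_neqP => xN; apply/rowP => j; rewrite mxE; apply/eqP.
rewrite eq_le x0 andbT leNgt; apply/negP => xj; apply: xN; by exists j.
Qed.

(** Sum the inequalities over [j] and use that coordinates of a simplex point are at most 1. This
    bounds the second component of the set maximised over below. *)
Lemma subeigen_bound A x t : (forall i j, 0 <= A i j) ->
  (forall j, 0 <= x 0 j) -> \sum_j x 0 j = 1 ->
  (forall j, t * x 0 j <= (x *m A) 0 j) -> t <= \sum_j \sum_i A i j.
Proof.
move=> A0 x0 x1 le_tx.
have x_le1 i : x 0 i <= 1.
  by rewrite -x1 (bigD1 i) //= lerDl; apply: sumr_ge0.
rewrite -[t]mulr1 -x1 mulr_sumr; apply: ler_sum => j _.
apply: le_trans (le_tx j) _; rewrite mxE; apply: ler_sum => i _.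
by rewrite ler_piMl.
Qed.

(** The admissible pairs [(x, t)] with [x] in the simplex and [0 <= t] form a closed subset [K] of a
    compact box [B], so [t] attains its maximum there. A general [y] is rescaled into the simplex,
    the inequality being homogeneous in [y]. *)
Lemma collatz_wielandt_max A : (forall i j, 0 <= A i j) ->
  exists r x, [/\ 0 <= r, (forall j, 0 <= x 0 j), x != 0,
    (forall j, r * x 0 j <= (x *m A) 0 j)
  & forall t y, (forall j, 0 <= y 0 j) -> y != 0 ->
      (forall j, t * y 0 j <= (y *m A) 0 j) -> t <= r].
Proof.
move=> A0; set M := \sum_j \sum_i A i j.
have M0 : 0 <= M by apply: sumr_ge0 => j _; exact: sumr_ge0.
pose I01 : set R := `[0, 1]%classic.
pose B : set ('rV[R]_n.+1 * R) :=
  ([set v : 'rV[R]_n.+1 | forall i, I01 (v ord0 i)]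
     `*` `[0, M])%classic.
pose K : set ('rV[R]_n.+1 * R) :=
  [set p : 'rV[R]_n.+1 * R |
    [/\ forall j, 0 <= p.1 0 j, \sum_j p.1 0 j = 1, 0 <= p.2 & forall j, p.2 * p.1 0 j <= (p.1 *m A) 0 j]]%classic.
have cB : compact B.
  apply: compact_setX; last exact: segment_compact.
  apply: (@rV_compact R n.+1 (fun=> I01)) => i.
  exact: segment_compact.
have KB : (K `<=` B)%classic.
  move=> [x t] [/= x0 x1 t0 le_tx]; split => /=.
    move=> i; rewrite /I01 /= in_itv /= x0 /= -x1 (bigD1 i) //= lerDl.
    by apply: sumr_ge0.
  by rewrite in_itv /= t0 (subeigen_bound A0 x0 x1 le_tx).
have c1 j : continuous (fun p : 'rV[R]_n.+1 * R => p.1 0 j).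
  move=> p; apply: (@continuous_comp _ _ _ fst (fun v : 'rV[R]_n.+1 => v 0 j)).
    exact: cvg_fst.
  exact: coord_continuous.
have c2 : continuous (fun p : 'rV[R]_n.+1 * R => p.2).
  by move=> p; exact: cvg_snd.
have csum (h : 'I_n.+1 -> 'rV[R]_n.+1 * R -> R) :
    (forall i, continuous (h i)) -> continuous (fun p => \sum_i h i p).
  move=> ch p; apply: cvg_big => //; first exact: add_continuous.
  by move=> i _; exact: ch.
have cA j : continuous (fun p : 'rV[R]_n.+1 * R => (p.1 *m A) 0 j).
  under eq_fun do rewrite mxE.
  by apply: csum => i q; apply: cvgM; [exact: c1|exact: cvg_cst].
have closed_nneg (h : 'rV[R]_n.+1 * R -> R) : continuous h ->
    closed [set p : 'rV[R]_n.+1 * R | 0 <= h p]%classic.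
  by move=> /continuous_closedP ch; exact: (ch _ (@closed_ge R 0)).
have clK : closed K.
  have -> : K = (((\bigcap_j [set p : 'rV[R]_n.+1 * R | 0 <= p.1 0 j]) `&`
     [set p : 'rV[R]_n.+1 * R | \sum_j p.1 0 j = 1]) `&`
     ([set p : 'rV[R]_n.+1 * R | 0 <= p.2] `&` (\bigcap_j
       [set p : 'rV[R]_n.+1 * R |
         (0 <= (p.1 *m A) 0 j - p.2 * p.1 0 j)%R])))%classic.
    apply/seteqP; split => -[x t].
      move=> [/= x0 x1 t0 le_tx]; split; split => //= j _ //=.
      by rewrite subr_ge0.
    move=> [[x0 x1] [t0 le_tx]]; split => //= j; first exact: x0.
    by rewrite -subr_ge0; exact: le_tx.
  apply: closedI; apply: closedI.
  - by apply: closed_bigI => j _; exact: closed_nneg.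
  - have /continuous_closedP csum1 := csum _ c1.
    exact: (csum1 _ (@closed_eq R 1)).
  - exact: closed_nneg.
  - apply: closed_bigI => j _; apply: closed_nneg => p.
    apply: cvgB; last by apply: cvgM; [exact: c2|exact: c1].
    exact: cA.
have cK : compact K := subclosed_compact clK cB KB.
have K0 : (K !=set0)%classic.
  exists (delta_mx 0 0, 0); split => //= [j||j].
  - by rewrite mxE; case: eqP.
  - rewrite (bigD1 0) //= mxE !eqxx big1 ?addr0 // => j /negPf j0.
    by rewrite mxE j0 andbF.
  - by rewrite mul0r; apply: mulmx_row_ge0 => // i; rewrite mxE; case: eqP.
have [|[x r]] := @compact_EVT_max _ R snd K K0 cK.
  by apply: continuous_subspaceT => p; exact: c2.
rewrite inE => -[/= x0 x1 r0 le_rx] r_max; exists r, x; split => //.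
  apply/negP => /eqP xE; move: x1; rewrite big1 => [/esym/eqP|j _].
    by rewrite oner_eq0.
  by rewrite xE mxE.
move=> t y y0 yN0 le_ty.
(* A negative [t] lies outside [K], but is below [r] since [0 <= r]. *)
have [t_lt0|t0] := ltP t 0; first exact: le_trans (ltW t_lt0) r0.
set s := \sum_j y 0 j.
have s0 : 0 < s.
  have [j yj] := rV_neq0_gt0 y0 yN0.
  by rewrite /s (bigD1 j) //= ltr_wpDr // sumr_ge0.
apply: (r_max (s^-1 *: y, t)); rewrite inE; split => //= [j||j].
- by rewrite mxE mulr_ge0 // invr_ge0 ltW.
- under eq_bigr do rewrite mxE; by rewrite -mulr_sumr mulVf // gt_eqF.
- rewrite /= -scalemxAl mxE [leRHS]mxE mulrCA ler_wpM2l ?invr_ge0 ?(ltW s0) //.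
Qed.

End CollatzWielandt.

(** * Eigenvectors of irreducible nonnegative matrices *)

Section PerronFrobenius.
Variables (R : realType) (n : nat).
Implicit Types (A P : 'M[R]_n.+1) (x y : 'rV[R]_n.+1).

Lemma irreducible_mx_tr A : irreducible_mx A -> irreducible_mx A^T.
Proof.
move=> irrA i j; have [k Ak] := irrA j i; exists k.
suff -> : A^T ^+ k = (A ^+ k)^T by rewrite mxE.
elim: k {Ak} => [|k IHk]; first by rewrite !expr0 [RHS]trmx1.
by rewrite exprS IHk exprSr [RHS]trmx_mul.
Qed.

Lemma mulmx_row_gt0 P x : (forall i j, 0 < P i j) ->
  (forall j, 0 <= x 0 j) -> x != 0 -> forall j, 0 < (x *m P) 0 j.
Proof.
move=> P0 x0 xN0 j; have [i xi] := rV_neq0_gt0 x0 xN0.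
rewrite mxE (bigD1 i) //= ltr_wpDr ?mulr_gt0 //.
by apply: sumr_ge0 => l _; rewrite mulr_ge0 // ltW.
Qed.

Lemma eigenrow_exp A x c k : x *m A = c *: x -> x *m A ^+ k = c ^+ k *: x.
Proof.
move=> xA; elim: k => [|k IHk]; first by rewrite !expr0 [LHS]mulmx1 scale1r.
by rewrite exprS [A * _]/GRing.mul /= mulmxA xA -scalemxAl IHk scalerA exprS.
Qed.

(** If [x] vanished at [j], so would [x A^k = c^k x]; but with [x] positive at [i] and
    [(A^k) i j > 0], that coordinate has a positive term. *)
Lemma eigenrow_gt0 A x c : (forall i j, 0 <= A i j) -> irreducible_mx A ->
  (forall j, 0 <= x 0 j) -> x != 0 -> x *m A = c *: x -> forall j, 0 < x 0 j.
Proof.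
move=> A0 irrA x0 xN0 xA j; have [i xi] := rV_neq0_gt0 x0 xN0.
have [k Ak] := irrA i j.
rewrite lt_neqAle x0 andbT eq_sym; apply/eqP => xj.
have := congr1 (fun v : 'rV_n.+1 => v 0 j) (eigenrow_exp k xA).
rewrite /= !mxE xj mulr0 (bigD1 i) //= => /eqP; rewrite gt_eqF // ltr_wpDr //.
  by apply: sumr_ge0 => l _; rewrite mulr_ge0 // expmx_ge0.
exact: mulr_gt0.
Qed.

(** For each pair choose a power of [A] positive at that entry; the sum of these powers is positive
    everywhere and is a polynomial in [A]. *)
Lemma comm_positive_mx A : (forall i j, 0 <= A i j) -> irreducible_mx A ->
  exists2 P, A *m P = P *m A & forall i j, 0 < P i j.
Proof.
move=> A0 irrA; have [k Ak] := choice (fun p => irrA p.1 p.2).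
exists (\sum_p A ^+ k p) => [|i j].
  by apply: commr_sum => p _; exact: commrX.
rewrite summxE (bigD1 (i, j)) //= ltr_wpDr ?(Ak (i, j)) //.
by apply: sumr_ge0 => p _; exact: expmx_ge0.
Qed.

Lemma le_scale_gt0 x y : (forall j, 0 < x 0 j) -> (forall j, 0 < y 0 j) ->
  exists2 e, 0 < e & forall j, e * x 0 j <= y 0 j.
Proof.
move=> x0 y0; set S := \sum_j x 0 j / y 0 j.
have le_S j : x 0 j / y 0 j <= S.
  rewrite /S (bigD1 j) //= lerDl; apply: sumr_ge0 => l _.
  by rewrite divr_ge0 ?ltW.
have S0 : 0 < S by apply: lt_le_trans (le_S 0); rewrite divr_gt0.
exists S^-1 => [|j]; first by rewrite invr_gt0.
by rewrite mulrC ler_pdivrMr // mulrC -ler_pdivrMr.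
Qed.

(* If [x A - r x] were nonzero, multiplying by a positive matrix commuting with
   [A] would make the inequality strict in every coordinate, and [r] could be
   increased. *)
Lemma collatz_wielandt_eigen A : (forall i j, 0 <= A i j) ->
  irreducible_mx A ->
  exists r x, [/\ 0 <= r, (forall j, 0 < x 0 j), x *m A = r *: x
  & forall t y, (forall j, 0 <= y 0 j) -> y != 0 ->
      (forall j, t * y 0 j <= (y *m A) 0 j) -> t <= r].
Proof.
move=> A0 irrA; have [r [x [r0 x0 xN0 le_rx r_max]]] := collatz_wielandt_max A0.
suff xA : x *m A = r *: x.
  by exists r, x; split => //; exact: eigenrow_gt0 xA.
apply/eqP; rewrite -subr_eq0; apply/negPn/negP => zN0.
have [P AP P0] := comm_positive_mx A0 irrA.
set z := x *m A - r *: x in zN0.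
have z0 j : 0 <= z 0 j by move: (le_rx j); rewrite -subr_ge0 !mxE.
have zP0 := mulmx_row_gt0 P0 z0 zN0.
have xP0 := mulmx_row_gt0 P0 x0 xN0.
have [e e0 le_e] := le_scale_gt0 xP0 zP0.
have : r + e <= r.
  apply: (r_max _ (x *m P)) => [j||j]; first exact: ltW.
    by apply/eqP => /rowP/(_ 0); move: (xP0 0) => /[swap] ->; rewrite mxE ltxx.
  have -> : x *m P *m A = r *: (x *m P) + z *m P.
    by rewrite mulmxBl -scalemxAl -!mulmxA AP addrC subrK.
  by rewrite mulrDl [leRHS]mxE [X in _ <= X + _]mxE lerD2l.
by rewrite leNgt ltrDl e0.
Qed.

(** By the triangle inequality, the coordinatewise moduli of a complex eigenvector [v] satisfy
    [|lambda| |v| <= |v| A], so the maximality of [r] applies. *)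
Lemma eigenvalue_norm_le A r (lambda : R[i]) : (forall i j, 0 <= A i j) ->
  (forall t y, (forall j, 0 <= y 0 j) -> y != 0 ->
      (forall j, t * y 0 j <= (y *m A) 0 j) -> t <= r) ->
  eigenvalue (map_mx (real_complex R) A) lambda ->
  `|lambda| <= real_complex R r.
Proof.
move=> A0 r_max /eigenvalueP [v vA vN0].
(* The norm on [R[i]] takes its values in [R[i]]; its real part brings it back to [R]. *)
have normcE (c : R[i]) : `|c| = real_complex R (complex.Re `|c|).
  by rewrite normc_def.
rewrite normcE lecR.
pose y : 'rV[R]_n.+1 := \row_j complex.Re `|v 0 j|.
apply: (r_max _ y) => [j||j].
- by rewrite mxE -(lecR 0) -normcE; exact: normr_ge0.
- apply: contra vN0 => /eqP/rowP y0; apply/eqP/rowP => j.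
  by move: (y0 j); rewrite !mxE => yj; apply/eqP; rewrite -normr_eq0 normcE yj.
- rewrite -lecR rmorphM /= mxE -!normcE -normrM.
  have := congr1 (fun w : 'rV_n.+1 => w 0 j) vA; rewrite /= !mxE => <-.
  apply: le_trans (ler_norm_sum _ _ _) _.
  rewrite rmorph_sum; apply: ler_sum => i _ /=.
  rewrite rmorphM /= !mxE -normcE normrM.
  by rewrite [`|real_complex R _|]ger0_norm // lecR.
Qed.

(* [|u| + u] and [|u| - u] are nonnegative eigenvectors, hence positive or zero,
   and they cannot both be positive. *)
Lemma eigenrow_orth_eq0 A r (mu u : 'rV[R]_n.+1) : (forall i j, 0 <= A i j) ->
  irreducible_mx A -> 0 <= r -> (forall j, 0 < mu 0 j) -> A *m mu^T = r *: mu^T ->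
  u *m A = r *: u -> \sum_j u 0 j * mu 0 j = 0 -> u = 0.
Proof.
move=> A0 irrA r0 mu0 muA uA u_mu.
pose a : 'rV[R]_n.+1 := \row_j `|u 0 j|.
have le_aA j : r * a 0 j <= (a *m A) 0 j.
  rewrite mxE -{1}(ger0_norm r0) -normrM.
  have := congr1 (fun w : 'rV_n.+1 => w 0 j) uA; rewrite /= !mxE => <-.
  apply: le_trans (ler_norm_sum _ _ _) _; apply: ler_sum => i _.
  by rewrite normrM mxE [`|A i j|]ger0_norm.
(* Pairing [a A - r a >= 0] with the positive right eigenvector [mu] gives 0, so every coordinate of
   the difference vanishes. *)
have aA : a *m A = r *: a.
  have : \sum_j ((a *m A) 0 j - r * a 0 j) * mu 0 j = 0.
    have := congr1 (fun w : 'M_1 => w 0 0) (congr1 (mulmx a) muA).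
    rewrite mulmxA -scalemxAr !mxE /= => aAmu.
    under eq_bigr do rewrite mulrBl.
    rewrite sumrB; apply/eqP; rewrite subr_eq0; apply/eqP.
    move: aAmu; under eq_bigr do rewrite [mu^T _ _]mxE.
    move->; rewrite mulr_sumr; apply: eq_bigr => j _.
    by rewrite [mu^T _ _]mxE mulrA.
  move=> /eqP; rewrite psumr_eq0 => [/allP aAmu|j _]; last first.
    by rewrite mulr_ge0 ?subr_ge0 // ltW.
  apply/rowP => j; have := aAmu j (mem_index_enum j).
  by rewrite /= mulf_eq0 [mu 0 j == 0]gt_eqF // orbF subr_eq0 [RHS]mxE => /eqP.
have dich (w : 'rV[R]_n.+1) : w *m A = r *: w -> \sum_j w 0 j * mu 0 j = 0 ->
    (forall j, w 0 j <= a 0 j) -> w = 0 \/ w 0 0 < a 0 0.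
  move=> wA w_mu le_wa; have [aw|aw] := eqVneq a w; [left|right].
    move/eqP: w_mu; rewrite psumr_eq0 => [/allP w_mu|j _]; last first.
      by rewrite mulr_ge0 ?(ltW (mu0 j)) // -aw mxE.
    apply/rowP => j; have := w_mu j (mem_index_enum j).
    by rewrite /= mulf_eq0 [mu 0 j == 0]gt_eqF // orbF [RHS]mxE => /eqP.
  have awE j : (a - w) 0 j = a 0 j - w 0 j by rewrite mxE [(- w) 0 j]mxE.
  rewrite -subr_gt0 -awE; apply: (eigenrow_gt0 (c := r) A0 irrA) => [j||].
  - by rewrite awE subr_ge0.
  - by rewrite subr_eq0.
  - by rewrite mulmxBl aA wA scalerBr.
have [|->//|u_lt] := dich u uA u_mu; first by move=> j; rewrite mxE ler_norm.
have [||j|/eqP|Nu_lt] := dich (- u).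
- by rewrite mulNmx uA scalerN.
- under eq_bigr do rewrite mxE mulNr; by rewrite sumrN u_mu oppr0.
- by rewrite !mxE -normrN ler_norm.
- by rewrite oppr_eq0 => /eqP.
- by move: u_lt Nu_lt; rewrite !mxE; case: (ger0P (u 0 0)); rewrite ltxx.
Qed.

End PerronFrobenius.

(** * Simplicity of the Perron root and existence of the Perron vector *)

Section PerronRoot.
Variables (R : realType) (n : nat).
Implicit Types (A : 'M[R]_n.+1).

(* Replacing the first row of [X I - A] by the combination of its rows with
   weights [mu] makes it [(X - r) mu]; a double root [r] would hence yield a real
   eigenvector orthogonal to [mu]. *)
Lemma mup_perron_root A r (mu : 'rV[R]_n.+1) : (forall i j, 0 <= A i j) ->
  irreducible_mx A -> 0 <= r -> (forall j, 0 < mu 0 j) -> mu *m A = r *: mu ->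
  mup r (char_poly A) = 1%N.
Proof.
move=> A0 irrA r0 mu0 muA.
have pN0 : char_poly A != 0 := monic_neq0 (char_poly_monic A).
have muN0 : mu != 0.
  by apply/eqP => /rowP/(_ 0); move: (mu0 0) => /[swap] ->; rewrite mxE ltxx.
have eig : eigenvalue A r by apply/eigenvalueP; exists mu.
apply/eqP; rewrite eqn_leq mup_leq // mup_geq // expr1 andbC.
rewrite dvdp_XsubCl -eigenvalue_root_char eig /=.
pose Q : 'M[{poly R}]_n.+1 :=
  \matrix_(i, j) if i == 0 then (mu 0 j)%:P else char_poly_mx A i j.
pose P : 'M[{poly R}]_n.+1 :=
  \matrix_(i, j) if i == 0 then (mu 0 j)%:P else (i == j)%:R.
pose D : 'rV[{poly R}]_n.+1 := \row_i if i == 0 then 'X - r%:P else 1.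
have PQ : P *m char_poly_mx A = diag_mx D *m Q.
  apply/matrixP => i j; rewrite mul_diag_mx [LHS]mxE !mxE.
  case: (eqVneq i 0) => [->|i0]; last first.
    rewrite mul1r (bigD1 i) //= big1 ?addr0 => [|l li]; last first.
      by rewrite mxE (negPf i0) eq_sym (negPf li) mul0r.
    by rewrite !mxE (negPf i0) eqxx mul1r.
  have := congr1 (fun w : 'rV_n.+1 => w 0 j) muA; rewrite /= !mxE => muAj.
  rewrite mulrBl -[r%:P * _]rmorphM /= -muAj rmorph_sum /=.
  under eq_bigr do rewrite mxE eqxx !mxE mulrBr.
  rewrite sumrB (bigD1 j) //= eqxx mulr1n big1 ?addr0 => [|l lj].
    rewrite ['X * _]mulrC; congr (_ - _); apply: eq_bigr => l _.
    by rewrite rmorphM.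
  by rewrite (negPf lj) mulr0n mulr0.
have detP : \det P = (mu 0 0)%:P.
  rewrite -det_tr det_trig; last first.
    apply/is_trig_mxP => i j ij; rewrite !mxE.
    by rewrite !(gt_eqF, lt_eqF) //; case: j ij => -[].
  rewrite big_ord_recl !mxE eqxx big1 ?mulr1 // => i _.
  by rewrite !mxE eqxx.
have detD : \det (diag_mx D) = 'X - r%:P.
  rewrite det_diag big_ord_recl mxE eqxx big1 ?mulr1 // => i _.
  by rewrite mxE.
have : \det (P *m char_poly_mx A) = \det (diag_mx D *m Q) by rewrite PQ.
rewrite !det_mulmx detP detD -/(char_poly A) => pQ.
apply/negP => dvd2.
have : ('X - r%:P) ^+ 2 %| ('X - r%:P) * \det Q by rewrite -pQ dvdp_mull.
(* Cancelling one factor [X - r] makes [Q] singular at [r]. A kernel vector [u] is orthogonal to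
   [mu] by row 0, and satisfies the eigenvector equation of [A^T] at every index but 0 by the other
   rows. *)
rewrite expr2 dvdp_mul2l ?polyXsubC_eq0 // dvdp_XsubCl /root -horner_evalE.
rewrite -det_map_mx -det_tr => /det0P [u uN0 uQ].
have uQ0 : \sum_j u 0 j * mu 0 j = 0.
  have := congr1 (fun w : 'rV_n.+1 => w 0 0) uQ; rewrite /= !mxE => E.
  rewrite -[RHS]E; apply: eq_bigr => j _.
  by rewrite !mxE eqxx /= horner_evalE hornerC.
have uQi i : i != 0 -> (u *m A^T) 0 i = r * u 0 i.
  move=> i0; have := congr1 (fun w : 'rV_n.+1 => w 0 i) uQ; rewrite /= !mxE.
  move=> E; apply/esym/subr0_eq; apply: etrans E.
  have <- : \sum_j u 0 j * ((i == j)%:R * r) = r * u 0 i.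
    rewrite (bigD1 i) //= eqxx mul1r mulrC big1 ?addr0 // => j ji.
    by rewrite eq_sym (negPf ji) mul0r mulr0.
  rewrite -sumrB; apply: eq_bigr => j _.
  rewrite !mxE (negPf i0) -mulrBr horner_evalE !hornerE; congr (_ * (_ - _)).
  by case: eqP => _; rewrite !hornerE ?mul1r ?mul0r.
(* The coordinate 0 follows from the others: [u A^T - r u] pairs to 0 with [mu], and [mu 0 0] is
   positive. *)
have uA : u *m A^T = r *: u.
  apply/rowP => i; rewrite [RHS]mxE; have [->|] := eqVneq i 0; last exact: uQi.
  have : \sum_i ((u *m A^T) 0 i - r * u 0 i) * mu 0 i = 0.
    have -> : \sum_i ((u *m A^T) 0 i - r * u 0 i) * mu 0 i =
        ((u *m A^T - r *: u) *m mu^T) 0 0.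
      rewrite [RHS]mxE; apply: eq_bigr => j _.
      congr (_ * _); rewrite [RHS]mxE //.
      by rewrite [X in _ = _ + X]mxE [X in _ = _ - X]mxE.
    rewrite mulmxBl -mulmxA -trmx_mul muA linearZ /= -scalemxAr -scalemxAl subrr.
    by rewrite mxE.
  rewrite (bigD1 0) //= big1 ?addr0 => [/eqP|j j0]; last first.
    by rewrite uQi // subrr mul0r.
  by rewrite mulf_eq0 [mu 0 0 == 0]gt_eqF // orbF subr_eq0 => /eqP.
case/eqP: uN0; apply: (eigenrow_orth_eq0 (A := A^T) (r := r) (mu := mu)) => //.
- by move=> i j; rewrite mxE.
- exact: irreducible_mx_tr.
- by rewrite -trmx_mul muA linearZ.
Qed.

(** Shows that both [xget] choices are made from nonempty sets: the Collatz-Wielandt maximum is a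
    Perron root, equal to the chosen one by mutual domination, and its eigenvector is normalised to
    sum 1. *)
Lemma perron_rootP A : (forall i j, 0 <= A i j) -> irreducible_mx A ->
  0 <= perron_root A /\ is_perron_vector A (perron_vector A).
Proof.
move=> A0 irrA.
have [r [x [r0 x0 xA r_max]]] := collatz_wielandt_eigen A0 irrA.
have xN0 : x != 0.
  by apply/eqP => /rowP/(_ 0); move: (x0 0) => /[swap] ->; rewrite mxE ltxx.
have dom := eigenvalue_norm_le A0 r_max.
have map_eigen t : eigenvalue A t ->
    eigenvalue (map_mx (real_complex R) A) (real_complex R t).
  move=> /eigenvalueP [v vA vN0]; apply/eigenvalueP.
  exists (map_mx (real_complex R) v); last by rewrite map_mx_eq0.
  by rewrite -map_mxM vA map_mxZ.
have eig : eigenvalue A r by apply/eigenvalueP; exists x.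
have norm_real t : `|real_complex R t| = real_complex R `|t|.
  by rewrite normc_def /= expr0n addr0 sqrtr_sqr.
have rootA : perron_root A = r.
  have : is_perron_root A (perron_root A).
    apply: xgetPex; exists r; split => //.
    exact: mup_perron_root xA.
  set t := perron_root A => -[eig_t _ dom_t]; apply/eqP; rewrite eq_le.
  have := dom _ (map_eigen _ eig_t); rewrite norm_real lecR => le_tr.
  have := dom_t _ (map_eigen _ eig); rewrite norm_real lecR => le_rt.
  by rewrite (le_trans (ler_norm _) le_tr) (le_trans (ler_norm _) le_rt).
rewrite rootA; split => //; apply: xgetPex.
set s := \sum_j x 0 j.
have s0 : 0 < s.
  by rewrite /s big_ord_recl ltr_wpDr // sumr_ge0 // => i _; exact: ltW.
exists (s^-1 *: x); split => [|j|].
- by rewrite rootA -scalemxAl xA !scalerA mulrC.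
- by rewrite mxE mulr_gt0 // invr_gt0.
- under eq_bigr do rewrite mxE; by rewrite -mulr_sumr mulVf // gt_eqF.
Qed.

End PerronRoot.

(** * Edge flows and stationarity *)

Section Flow.
Variables (R : realType) (d : nat) (E : {set 'I_d.+1 * 'I_d.+1}).
Implicit Types (f eta zeta : edge E -> R).

(** Groups the edges by source; [sum_inflow] groups them by target. Together they move a weight from
    one end of the edges to the other. *)
Lemma sum_outflow eta (L : 'I_d.+1 -> R) :
  \sum_x outflow eta x * L x = \sum_e eta e * L (src e).
Proof.
rewrite [RHS](partition_big (@src d E) predT) //=; apply: eq_bigr => x _.
by rewrite /outflow mulr_suml; apply: eq_bigr => e /eqP ->.
Qed.

Lemma sum_inflow eta (L : 'I_d.+1 -> R) :
  \sum_x inflow eta x * L x = \sum_e eta e * L (tgt e).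
Proof.
rewrite [RHS](partition_big (@tgt d E) predT) //=; apply: eq_bigr => x _.
by rewrite /inflow mulr_suml; apply: eq_bigr => e /eqP ->.
Qed.

(** The last edge of a nonempty closed walk from [x] to [x] enters [x]. *)
Lemma inflow_gt0 eta x : strongly_connected E -> Mbar eta -> 0 < inflow eta x.
Proof.
move=> hE eta0; have [s [+ + sx]] := hE x x.
case/lastP: s sx => // s y; rewrite last_rcons => -> _.
rewrite rcons_path => /andP [_ yE].
rewrite /inflow (bigD1 (exist (fun p => p \in E) _ yE : edge E)) //=.
rewrite ltr_wpDr ?eta0 //.
by apply: sumr_ge0 => e _; exact: ltW.
Qed.

Lemma weight_mx_ge0 f : Fplus f -> forall i j, 0 <= weight_mx f i j.
Proof.
by move=> f0 i j; rewrite mxE; case: insub => [e|] //=; exact: ltW.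
Qed.

Lemma expmx_path_gt0 (A : 'M[R]_d.+1) x s : (forall i j, 0 <= A i j) ->
  path (fun i j => 0 < A i j) x s -> 0 < (A ^+ size s) x (last x s).
Proof.
move=> A0; elim: s x => [|y s IHs] x /=; first by rewrite expr0 mxE eqxx.
move=> /andP [xy ys]; rewrite exprS mxE (bigD1 y) //= ltr_wpDr //.
  by apply: sumr_ge0 => z _; rewrite mulr_ge0 // expmx_ge0.
by rewrite mulr_gt0 // IHs.
Qed.

Lemma weight_mx_irreducible f : strongly_connected E -> Fplus f ->
  irreducible_mx (weight_mx f).
Proof.
move=> hE f0 x y; have [s [_ xs <-]] := hE x y; exists (size s).
apply: expmx_path_gt0; first exact: weight_mx_ge0.
apply: sub_path xs => a b abE; rewrite mxE.
by rewrite insubT /= f0.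
Qed.

(** Turns a coordinate of the eigenvector equation into a statement about inflow: pairs outside [E]
    contribute 0, and an edge is determined by its two ends. *)
Lemma sum_weight_mx f (v : 'I_d.+1 -> R) y :
  \sum_x v x * weight_mx f x y = inflow (fun e => v (src e) * f e) y.
Proof.
rewrite /inflow (partition_big (@src d E) predT) //=; apply: eq_bigr => x _.
rewrite mxE; case: insubP => [e _ eE|xyN] /=.
  have [-> ->] : x = src e /\ y = tgt e by rewrite /src /tgt eE.
  rewrite (big_pred1 e) // => e' /=.
  apply/idP/eqP => [|->]; last by rewrite !eqxx.
  case/andP => /eqP te /eqP se; apply: val_inj.
  rewrite (surjective_pairing (val e')) (surjective_pairing (val e)).
  by congr pair.
rewrite mulr0 big_pred0 // => e; apply: contraNF xyN => /andP [/eqP <- /eqP <-].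
by rewrite -surjective_pairing (valP e).
Qed.

Lemma pf_vec_gt0 f x : strongly_connected E -> Fplus f -> 0 < pf_vec f x.
Proof.
move=> hE f0.
have [_ [_ mu0 _]] :=
  perron_rootP (weight_mx_ge0 f0) (weight_mx_irreducible hE f0).
exact: mu0.
Qed.

Lemma Tbar_Mbar f : strongly_connected E -> Fplus f -> Mbar (Tbar f).
Proof. by move=> hE f0 e; rewrite mulr_gt0 ?pf_vec_gt0 ?f0. Qed.

Lemma inflow_Tbar f x : strongly_connected E -> Fplus f ->
  inflow (Tbar f) x = pf_root f * pf_vec f x.
Proof.
move=> hE f0.
have [_ [muA _ _]] :=
  perron_rootP (weight_mx_ge0 f0) (weight_mx_irreducible hE f0).
have := congr1 (fun w : 'rV_d.+1 => w 0 x) muA; rewrite /= [RHS]mxE => <-.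
by rewrite mxE sum_weight_mx.
Qed.

(** The product of the root with a positive coordinate of [pf_vec f] is an inflow, hence
    positive. *)
Lemma pf_root_gt0 f : strongly_connected E -> Fplus f -> 0 < pf_root f.
Proof.
move=> hE f0; have := inflow_gt0 ord0 hE (Tbar_Mbar hE f0).
by rewrite inflow_Tbar // pmulr_lgt0 // pf_vec_gt0.
Qed.

End Flow.

(** * Derivatives and Bregman divergence of the potential *)

Section Potential.
Variables (R : realType) (d : nat) (E : {set 'I_d.+1 * 'I_d.+1}).
Implicit Types (eta zeta : edge E -> R) (e : edge E).

Lemma is_derive_bigsum (I : finType) (P : pred I) (h : I -> R -> R)
    (dh : I -> R) (x : R) : (forall i, is_derive x 1 (h i) (dh i)) ->
  is_derive x 1 (fun t => \sum_(i | P i) h i t) (\sum_(i | P i) dh i).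
Proof.
move=> hP; rewrite -fct_sumE.
by elim/big_ind2 : _ => // [|] *; [exact: is_derive_cst|exact: is_deriveD].
Qed.

(** Serves both sums of [phibar]: with [g = h] an edge coordinate, and with [g] an outflow and [h]
    an inflow. *)
Lemma is_derive_mul_ln (g h : R -> R) (x dg dh : R) : 0 < h x ->
  is_derive x 1 g dg -> is_derive x 1 h dh ->
  is_derive x 1 (fun t => g t * ln (h t)) (dg * ln (h x) + g x * dh / h x).
Proof.
move=> hx0 dgx dhx.
have dln := is_derive1_comp (is_derive1_ln hx0) dhx.
apply: is_derive_eq (is_deriveM dgx dln) _.
by rewrite /= /GRing.scale /=; ring.
Qed.

(** The coordinate at [e] enters its own term, the outflow of [src e] and the inflow of [tgt e];
    these yield [ln + 1], the logarithm and the quotient respectively. *)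
Lemma is_derive_phibar eta e : strongly_connected E -> Mbar eta ->
  is_derive (eta e) 1 (coord_line (@phibar R d E) eta e)
    (ln (eta e) + 1 - ln (inflow eta (src e))
     - outflow eta (tgt e) / inflow eta (tgt e)).
Proof.
move=> hE eta0.
pose h e' t : R := [eta eta with e |-> t] e'.
have h_eta e' : h e' (eta e) = eta e'.
  by rewrite /h /=; case: eqP => [->|].
have dh e' : is_derive (eta e) 1 (h e') (e' == e)%:R.
  rewrite /h /=; case: eqP => _; first exact: is_derive_id.
  exact: is_derive_cst.
(* A sum of coordinates over [P] has derivative 1 or 0 according to whether [e] satisfies [P]; this
   covers inflows and outflows at once. *)
have dflow (P : pred (edge E)) : is_derive (eta e) 1
    (fun t => \sum_(e' | P e') h e' t) (P e)%:R.
  apply: is_derive_eq (is_derive_bigsum P dh) _.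
  rewrite big_mkcond (bigD1 e) //= eqxx big1 ?addr0; first by case: (P e).
  by move=> e' /negPf ->; case: (P e').
have flow_eta (P : pred (edge E)) :
    \sum_(e' | P e') h e' (eta e) = \sum_(e' | P e') eta e'.
  by apply: eq_bigr => e' _.
have out_eta x : \sum_(e' | src e' == x) h e' (eta e) = outflow eta x.
  exact: flow_eta.
have in_eta x : \sum_(e' | tgt e' == x) h e' (eta e) = inflow eta x.
  exact: flow_eta.
have d1 := is_derive_bigsum predT (fun e' =>
  is_derive_mul_ln (etrans (congr1 _ (h_eta e')) (eta0 e')) (dh e') (dh e')).
have in0 x : 0 < \sum_(e' | tgt e' == x) h e' (eta e).
  by rewrite in_eta inflow_gt0.
have d2 := is_derive_bigsum predT (fun x =>
  is_derive_mul_ln (in0 x) (dflow (fun e' => src e' == x))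
    (dflow (fun e' => tgt e' == x))).
apply: is_derive_eq (is_deriveB d1 d2) _.
rewrite (bigD1 e) //= eqxx big1 ?addr0 => [|e' /negPf ->]; last first.
  by rewrite mul0r mulr0 mul0r addr0.
rewrite h_eta mul1r mulr1 divff ?gt_eqF ?eta0 // big_split /=.
have delta y (G : 'I_d.+1 -> R) : \sum_x (y == x)%:R * G x = G y.
  rewrite (bigD1 y) //= eqxx mul1r big1 ?addr0 // => x /negPf xy.
  by rewrite eq_sym xy mul0r.
rewrite delta; under [X in _ - (_ + X)]eq_bigr do rewrite mulrAC mulrC.
rewrite delta.
by rewrite in_eta out_eta in_eta opprD addrA.
Qed.

Lemma phibarE eta :
  phibar eta = \sum_e eta e * (ln (eta e) - ln (inflow eta (src e))).
Proof.
rewrite /phibar (sum_outflow eta (fun x => ln (inflow eta x))) -sumrB.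
by apply: eq_bigr => e _; rewrite mulrBr.
Qed.

Lemma partial_phibar eta e : strongly_connected E -> Mbar eta ->
  partial (@phibar R d E) e eta =
  ln (eta e) + 1 - ln (inflow eta (src e))
  - outflow eta (tgt e) / inflow eta (tgt e).
Proof.
move=> hE eta0; rewrite /partial derive1E.
by have [_ ->] := is_derive_phibar e hE eta0.
Qed.

(* [phibar] is homogeneous of degree one, so by Euler's identity the terms
   [- phibar zeta + \sum_e partial phibar e zeta * zeta e] cancel. *)
Lemma euler_phibar zeta : strongly_connected E -> Mbar zeta ->
  \sum_e partial (@phibar R d E) e zeta * zeta e = phibar zeta.
Proof.
move=> hE zeta0.
(* Grouping by target cancels the inflows and leaves the total outflow, so the quotients in the
   partial derivatives balance the constants 1. *)
have out_in : \sum_e zeta e * (outflow zeta (tgt e) / inflow zeta (tgt e)) =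
    \sum_e zeta e.
  rewrite -(sum_inflow zeta (fun x => outflow zeta x / inflow zeta x)).
  under [RHS]eq_bigr do rewrite -[zeta _]mulr1.
  rewrite -(sum_outflow zeta (fun=> 1)); apply: eq_bigr => x _.
  by rewrite mulr1 mulrC divfK // gt_eqF // inflow_gt0.
apply: etrans (addrK (\sum_e zeta e) _); rewrite -{2}out_in phibarE.
rewrite -big_split -sumrB /=; apply: eq_bigr => e _.
by rewrite partial_phibar //; ring.
Qed.

(** Euler's identity leaves [phibar eta] minus the gradient at [zeta] paired with [eta], both of
    which are edge sums weighted by [eta]. *)
Lemma bregman_phibar eta zeta : strongly_connected E -> Mbar zeta ->
  bregman (@phibar R d E) eta zeta =
  \sum_e eta e * ((ln (eta e) - ln (inflow eta (src e)))
    - (ln (zeta e) - ln (inflow zeta (src e)))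
    + outflow zeta (tgt e) / inflow zeta (tgt e) - 1).
Proof.
move=> hE zeta0; rewrite /bregman.
under eq_bigr do rewrite mulrBr.
rewrite sumrB euler_phibar // addrA subrK phibarE -sumrB.
by apply: eq_bigr => e _; rewrite partial_phibar //; ring.
Qed.

End Potential.

(** * Comparison of the two divergences *)

Theorem theorem3p4 (R : realType) (d : nat) (hd : (1 <= d)%N)
    (E : {set 'I_d.+1 * 'I_d.+1}) (hE : strongly_connected E)
    (F : R -> R) (hF : forall t : R, 0 < t -> F t = - ln t + (t - 1)) :
  (forall eta : edge E -> R, Mbar eta ->
     forall e : edge E, partial_derivable (@phibar R d E) e eta) /\
  (forall f g : edge E -> R, Fplus f -> Fplus g ->
     Fdivergence F f g = bregman (@phibar R d E) (Tbar f) (Tbar g)).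
Proof.
split=> [eta eta0 e|f g f0 g0]; first by case: (is_derive_phibar e hE eta0).
have rf0 := pf_root_gt0 hE f0; have rg0 := pf_root_gt0 hE g0.
have mf0 x := pf_vec_gt0 x hE f0; have mg0 x := pf_vec_gt0 x hE g0.
have lnT (h : edge E -> R) (h0 : Fplus h) e :
    ln (Tbar h e) - ln (inflow (Tbar h) (src e)) = ln (h e / pf_root h).
  have r0 := pf_root_gt0 hE h0; have m0 := pf_vec_gt0 (src e) hE h0.
  rewrite inflow_Tbar // -ln_div ?posrE ?mulr_gt0 ?h0 //; congr ln.
  rewrite /Tbar; move: (pf_root h) (pf_vec h _) r0 m0 => r m r0 m0.
  by field; rewrite !gt_eqF.
rewrite bregman_phibar //; last exact: Tbar_Mbar.
rewrite -[Fdivergence F f g]/(\sum_e Tbar f e *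
  F ((g e / pf_root g) / (f e / pf_root f))).
under [RHS]eq_bigr do rewrite !lnT //.
(* The linear terms agree only after summation. Exchanging [inflow (Tbar f)] with [outflow (Tbar g)]
   regroups the right side from targets to sources, where stationarity makes both sides equal edge
   by edge. *)
have cross : \sum_e Tbar f e * ((g e / pf_root g) / (f e / pf_root f)) =
    \sum_e Tbar f e * (outflow (Tbar g) (tgt e) / inflow (Tbar g) (tgt e)).
  rewrite -(sum_inflow (Tbar f)
    (fun x => outflow (Tbar g) x / inflow (Tbar g) x)).
  under [RHS]eq_bigr do rewrite mulrCA.
  rewrite (sum_outflow (Tbar g)
    (fun x => inflow (Tbar f) x / inflow (Tbar g) x)).
  apply: eq_bigr => e _; rewrite !inflow_Tbar // /Tbar.
  move: (pf_root f) (pf_root g) (pf_vec f _) (pf_vec g _) rf0 rg0 (mf0 (src e))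
    (mg0 (src e)) (f0 e) => r s m m' r0 s0 m0 m'0 fe0.
  by field; rewrite !gt_eqF.
(* The difference of the two sides is matched with the difference of the two sums in [cross], which
   is 0; what remains is an identity on each edge. *)
apply: subr0_eq.
apply: etrans (subrr (\sum_e Tbar f e *
  ((g e / pf_root g) / (f e / pf_root f)))).
rewrite [in X in _ = _ - X]cross -!sumrB; apply: eq_bigr => e _.
have gr0 := divr_gt0 (g0 e) rg0; have fr0 := divr_gt0 (f0 e) rf0.
rewrite (hF _ (divr_gt0 gr0 fr0)).
move: (g e / _) (f e / _) (Tbar f e) gr0 fr0 => a b t a0 b0.
rewrite ln_div ?posrE //.
move: (outflow _ _ / _) => q; ring.
Qed.
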